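(* The Cayley form $\omega_{\rm Ca}\in\Lambda^4(\mathbb R^8)$ has comass $\|\omega_{\rm Ca}\|=1$ and satisfies $$\frac{|\omega_{\rm Ca}|^2}{\|\omega_{\rm Ca}\|^2}=14,$$ and the value $14$ is the maximal possible value of the ratio $|\omega|^2/\|\omega\|^2$ over all nonzero (alternating) $4$-forms $\omega$ on $\mathbb R^8$.
   Context: $\mathbb R^8$ carries its standard Euclidean inner product and orientation; $e_1,\dots,e_8$ is the basis of the dual space which is dual to the standard orthonormal basis. The Euclidean norm $|\cdot|$ on $\Lambda^4(\mathbb R^8)$ is the one for which the forms $e_j\wedge e_k\wedge e_l\wedge e_m$ ($j<k<l<m$) are orthonormal. The comass of a $k$-form $\omega$ is $\|\omega\|=\sup\{\omega(v_1,\dots,v_k): |v_i|=1 \text{ for all } i\}$. For distinct indices write $e^{jklm}:=e_j\wedge e_k\wedge e_l\wedge e_m+{*}(e_j\wedge e_k\wedge e_l\wedge e_m)$, where $*$ is the Hodge star. The Cayley form is $$\omega_{\rm Ca}=e^{1234}+e^{1256}+e^{1278}+e^{1357}-e^{1368}-e^{1458}-e^{1467}.$$ Equivalently, $\omega_{\rm Ca}=\tfrac12\omega_J^2+\mathrm{Re}(\Omega_J)$, where $\omega_J=\sum_{a=1}^4 e_{2a-1}\wedge e_{2a}$ and $\Omega_J=(e_1+ie_2)\wedge(e_3+ie_4)\wedge(e_5+ie_6)\wedge(e_7+ie_8)$. *)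

(* Defs.v *)
From HB Require Import structures.
From mathcomp Require Import all_boot all_order all_algebra.
From mathcomp Require Import all_classical all_reals.

Set Implicit Arguments.
Unset Strict Implicit.
Unset Printing Implicit Defensive.

Import Order.TTheory GRing.Theory Num.Theory.
Local Open Scope classical_set_scope.
Local Open Scope ring_scope.

(* A k-tuple (v_1, ..., v_k) of vectors of R^n is the k x n matrix with rows
   v_i, and a k-form is a function of this matrix; forms are added pointwise. *)

Definition alternating_form (R : realType) (k n : nat)
    (w : 'M[R]_(k, n) -> R) : Prop :=
  (forall (A B C : 'M[R]_(k, n)) (i : 'I_k) (b c : R),
      row i A = b *: row i B + c *: row i C ->
      row' i B = row' i A -> row' i C = row' i A ->
      w A = b * w B + c * w C) /\
  (forall (A : 'M[R]_(k, n)) (i j : 'I_k),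
      i != j -> row i A = row j A -> w A = 0).

(* The norm `|v| of the library on matrices is the sup norm. *)
Definition vec_norm (R : realType) (n : nat) (v : 'rV[R]_n) : R :=
  Num.sqrt (\sum_(i < n) v 0 i ^+ 2).

Definition comass (R : realType) (k n : nat) (w : 'M[R]_(k, n) -> R) : R :=
  sup [set w V | V in [set V : 'M[R]_(k, n) |
                        forall i : 'I_k, vec_norm (row i V) = 1]].

Definition increasing (k n : nat) (I : {ffun 'I_k -> 'I_n}) : bool :=
  [forall i : 'I_k, forall j : 'I_k, (i < j)%N ==> (I i < I j)%N].

(* The rows are the standard basis vectors with indices I 0, ..., I (k - 1);
   for increasing I, the value of a form on this frame is its coefficient on
   the basis form of multi-index I. *)
Definition std_frame (R : realType) (k n : nat) (I : {ffun 'I_k -> 'I_n}) :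
    'M[R]_(k, n) :=
  rowsub I 1%:M.

Definition form_norm (R : realType) (k n : nat) (w : 'M[R]_(k, n) -> R) : R :=
  Num.sqrt (\sum_(I : {ffun 'I_k -> 'I_n} | increasing I)
              w (std_frame R I) ^+ 2).

(* (a_1 /\ ... /\ a_k)(v_1, ..., v_k) = det (a_i (v_j)), with no 1 / k!. *)
Definition wedge (R : realType) (k n : nat) (a : k.-tuple ('rV[R]_n -> R)) :
    'M[R]_(k, n) -> R :=
  fun V => \det (\matrix_(i < k, j < k) tnth a i (row j V)).

(* The linear map sending the basis form of increasing multi-index I to
   vol (e_I, -), where vol = \det; that is, to the sign of the permutation
   (I, J) times the basis form of the complementary multi-index J, so that
   w /\ hodge w = |w|^2 vol. *)
Definition hodge (R : realType) (k m : nat) (w : 'M[R]_(k, k + m) -> R) :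
    'M[R]_(m, k + m) -> R :=
  fun V => \sum_(I : {ffun 'I_k -> 'I_(k + m)} | increasing I)
             w (std_frame R I) * \det (col_mx (std_frame R I) V).

(* Indices run from 1 to 8. *)
Definition dual_basis (R : realType) (j : nat) : 'rV[R]_8 -> R :=
  fun v => v 0 (inord j.-1).
Arguments dual_basis : clear implicits.

Definition sd_form (R : realType) (j k l m : nat) : 'M[R]_(4, 8) -> R :=
  let w := wedge [tuple dual_basis R j; dual_basis R k;
                        dual_basis R l; dual_basis R m] in
  w + @hodge R 4 4 w.
Arguments sd_form : clear implicits.

Definition cayley_form (R : realType) : 'M[R]_(4, 8) -> R :=
  sd_form R 1 2 3 4 + sd_form R 1 2 5 6 + sd_form R 1 2 7 8
  + sd_form R 1 3 5 7 - sd_form R 1 3 6 8 - sd_form R 1 4 5 8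
  - sd_form R 1 4 6 7.
Arguments cayley_form : clear implicits.

(* Main.v *)
(** Upper bound: fix three distinct basis vectors; completing them by the unit
    vector dual to the contraction of [w] with them shows that the squared norm
    of this contraction is at most [comass w ^+ 2].  Summing over the 8 * 7 * 6
    ordered triples counts every squared coefficient of [w] 4! = 24 times, so
    [24 |w|^2 <= 336 (comass w)^2], which is the constant 14.

    Comass of the Cayley form: writing it as the inner product of the last vector
    with a triple cross product [X u v w], the cross product satisfies
    [|X u v w|^2 + |<u,v> w - <u,w> v + <v,w> u|^2 = |u|^2 |v|^2 |w|^2], hence
    has norm at most 1 on unit vectors. *)
Require Import Defs.
From HB Require Import structures.
From mathcomp Require Import all_boot all_order all_algebra all_fingroup.
From mathcomp Require Import all_classical all_reals.
From mathcomp Require Import ring lra zify.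

Set Implicit Arguments.
Unset Strict Implicit.
Unset Printing Implicit Defensive.

Import Order.TTheory GRing.Theory Num.Theory.
Local Open Scope classical_set_scope.
Local Open Scope ring_scope.

(** * Rows of frames and unit vectors *)

Definition set_row (R : Type) k n (A : 'M[R]_(k, n)) (i : 'I_k) (v : 'rV[R]_n) :
    'M[R]_(k, n) :=
  \matrix_(p, q) if p == i then v 0 q else A p q.

Section Frames.
Variables (R : realType) (k n : nat).
Implicit Types (A : 'M[R]_(k, n)) (v : 'rV[R]_n) (I : {ffun 'I_k -> 'I_n}).

Lemma row_set_row A i v : row i (set_row A i v) = v.
Proof. by apply/rowP => q; rewrite !mxE eqxx. Qed.

Lemma row_set_row_neq A i j v : j != i -> row j (set_row A i v) = row j A.
Proof. by move=> /negPf ji; apply/rowP => q; rewrite !mxE ji. Qed.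

Lemma row'_set_row A i v : row' i (set_row A i v) = row' i A.
Proof.
by apply/matrixP => p q; rewrite !mxE eq_sym (negPf (neq_lift _ _)).
Qed.

Lemma set_row_id A i : set_row A i (row i A) = A.
Proof. by apply/matrixP => p q; rewrite !mxE; case: eqP => // ->. Qed.

Lemma set_row_set_row A i v v' : set_row (set_row A i v) i v' = set_row A i v'.
Proof. by apply/matrixP => p q; rewrite !mxE; case: eqP. Qed.

Lemma vec_normE v : vec_norm v ^+ 2 = \sum_j v 0 j ^+ 2.
Proof. by rewrite sqr_sqrtr // sumr_ge0 // => j _; rewrite sqr_ge0. Qed.

Lemma vec_norm1 v : (vec_norm v = 1) <-> (\sum_j v 0 j ^+ 2 = 1).
Proof.
split=> [v1|v1]; first by rewrite -vec_normE v1 expr1n.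
by rewrite /vec_norm v1 sqrtr1.
Qed.

Lemma vec_norm_delta j : vec_norm (delta_mx 0 j : 'rV[R]_n) = 1.
Proof.
apply/vec_norm1; rewrite (bigD1 j) //= big1 => [|l /negPf lj].
  by rewrite !mxE !eqxx expr1n addr0.
by rewrite !mxE lj andbF expr0n.
Qed.

Lemma row_std_frame I i : row i (std_frame R I) = delta_mx 0 (I i).
Proof. by apply/rowP => q; rewrite !mxE !eqxx eq_sym. Qed.

Lemma vec_norm_entry_le1 v j : vec_norm v = 1 -> `|v 0 j| <= 1.
Proof.
move=> /vec_norm1 v1; rewrite -(@ler_pXn2r _ 2) ?nnegrE //.
rewrite expr1n real_normK ?num_real // -v1 (bigD1 j) //= lerDl.
by rewrite sumr_ge0 // => l _; rewrite sqr_ge0.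
Qed.

End Frames.

(** * Alternating forms: row expansion, signs, boundedness on unit frames *)

Section Alternating.
Variables (R : realType) (k n : nat) (w : 'M[R]_(k, n) -> R).
Hypothesis w_alt : alternating_form w.

Let w_lin A i b c v v' :
  w (set_row A i (b *: v + c *: v')) =
  b * w (set_row A i v) + c * w (set_row A i v').
Proof. by apply: (w_alt.1 _ _ _ i); rewrite ?row_set_row ?row'_set_row. Qed.

Lemma alternating_row0 A i : w (set_row A i 0) = 0.
Proof.
by have := w_lin A i 0 0 0 0; rewrite !scale0r addr0 !mul0r addr0.
Qed.

Lemma alternating_row_expand A i :
  w A = \sum_j A i j * w (set_row A i (delta_mx 0 j)).
Proof.
have row_sum (s : seq 'I_n) (f : 'I_n -> R) :
    w (set_row A i (\sum_(j <- s) f j *: delta_mx 0 j)) =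
    \sum_(j <- s) f j * w (set_row A i (delta_mx 0 j)).
  elim: s => [|j s IH]; first by rewrite !big_nil alternating_row0.
  by rewrite !big_cons -[X in _ + X]scale1r w_lin IH mul1r.
rewrite -[in LHS](set_row_id A i) [row i A]row_sum_delta row_sum.
by apply: eq_bigr => j _; rewrite mxE.
Qed.

(** Polarization: with the sum of rows [i] and [j] in both places the value is 0, and only the two
    mixed terms of its expansion survive. *)
Lemma alternating_xrow A i j : i != j -> w (xrow i j A) = - w A.
Proof.
move=> ij; pose B v v' := set_row (set_row A i v) j v'.
have BC v v' : B v v' = set_row (set_row A j v') i v.
  apply/matrixP => p q; rewrite !mxE; case: eqP => // -> .
  by rewrite eq_sym (negPf ij).
have B0 v : w (B v v) = 0.
  apply: (w_alt.2 _ _ _ ij).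
  by rewrite row_set_row /B row_set_row_neq // row_set_row.
have BDl v1 v2 v' : w (B (v1 + v2) v') = w (B v1 v') + w (B v2 v').
  by rewrite !BC -[v1]scale1r -[v2]scale1r w_lin !scale1r !mul1r.
have BDr v v1 v2 : w (B v (v1 + v2)) = w (B v v1) + w (B v v2).
  by rewrite /B -[v1]scale1r -[v2]scale1r w_lin !scale1r !mul1r.
have := B0 (row i A + row j A); rewrite BDl !BDr !B0 add0r addr0.
have -> : B (row i A) (row j A) = A.
  by rewrite /B set_row_id set_row_id.
have -> : B (row j A) (row i A) = xrow i j A.
  apply/matrixP => p q; rewrite /B !mxE.
  case: tpermP => [->|->|/eqP/negPf pi /eqP/negPf pj].
  - by rewrite (negPf ij) eqxx.
  - by rewrite eqxx.
  - by rewrite pi pj.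
by move=> /eqP; rewrite addrC addr_eq0 => /eqP.
Qed.

(** A permutation is a product of transpositions, and each changes only the sign, which the square
    forgets. *)
Lemma alternating_row_perm_sqr A s : w (row_perm s A) ^+ 2 = w A ^+ 2.
Proof.
case: (prod_tpermP s) => ts -> {s}; elim: ts => [|t ts IH] in A *.
  by move=> _; rewrite big_nil row_perm1.
case/andP=> tneq /IH {}IH; rewrite big_cons row_permM /=.
have -> : row_perm (tperm t.1 t.2) (row_perm (\prod_(t <- ts) tperm t.1 t.2)%g A)
  = xrow t.1 t.2 (row_perm (\prod_(t <- ts) tperm t.1 t.2)%g A) by [].
by rewrite alternating_xrow // sqrrN IH.
Qed.

(** The supremum of an unbounded set is a default value, so [le_comass] rests on this bound.
    Induction on the number [m] of leading rows that may be arbitrary unit vectors, the other rows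
    being basis vectors; freeing one more row costs a factor [n], as the entries of a unit vector
    have absolute value at most 1. *)
Lemma alternating_bounded :
  exists C, forall V, (forall i, vec_norm (row i V) = 1) -> `|w V| <= C.
Proof.
suff: forall m, exists C, forall V,
    (forall i : 'I_k, vec_norm (row i V) = 1) ->
    (forall i : 'I_k, (m <= i)%N -> exists j, row i V = delta_mx 0 j) ->
    `|w V| <= C.
  move=> /(_ k)[C C_bound]; exists C => V V1; apply: C_bound => // i.
  by rewrite leqNgt ltn_ord.
elim=> [|m [C C_bound]].
  exists (\sum_I `|w (std_frame R I)|) => V _ V_std.
  have {V_std} /fin_all_exists[I V_I] i : exists j, row i V = delta_mx 0 j.
    exact: V_std.
  have -> : V = std_frame R (finfun I).
    by apply/row_matrixP => i; rewrite row_std_frame ffunE.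
  by rewrite (bigD1 (finfun I)) //= lerDl sumr_ge0.
have [mk|km] := ltnP m k; last first.
  exists C => V V1 V_std; apply: C_bound => // i mi.
  by have := leq_ltn_trans (leq_trans km mi) (ltn_ord i); rewrite ltnn.
pose i0 := Ordinal mk; exists (\sum_(j < n) C) => V V1 V_std.
rewrite (alternating_row_expand V i0); apply: le_trans (ler_norm_sum _ _ _) _.
apply: ler_sum => j _; rewrite normrM -[C]mul1r ler_pM //.
  by have := vec_norm_entry_le1 j (V1 i0); rewrite mxE.
apply: C_bound => i.
  have [->|ii0] := eqVneq i i0; first by rewrite row_set_row vec_norm_delta.
  by rewrite row_set_row_neq.
have [-> _|ii0] := eqVneq i i0; first by exists j; rewrite row_set_row.
rewrite leq_eqVlt row_set_row_neq // => /orP[/eqP mi|]; last exact: V_std.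
by case/eqP: ii0; apply/val_inj.
Qed.

Lemma le_comass V : (forall i, vec_norm (row i V) = 1) -> w V <= comass w.
Proof.
move=> V1; apply: ub_le_sup; last by exists V.
have [C C_bound] := alternating_bounded.
by exists C => _ [U U1 <-]; apply: le_trans (ler_norm _) (C_bound _ U1).
Qed.

End Alternating.

(** * Comparison of the Euclidean norm with the comass *)

Lemma increasing_inj k n (I : {ffun 'I_k -> 'I_n}) :
  increasing I -> injective I.
Proof.
move=> /forallP incI i j Iij; apply/eqP; rewrite -val_eqE eqn_leq.
apply/andP; split; rewrite leqNgt; apply/negP => lt_ij.
  by have := implyP (forallP (incI j) i) lt_ij; rewrite Iij ltnn.
by have := implyP (forallP (incI i) j) lt_ij; rewrite Iij ltnn.
Qed.

(** An increasing multi-index is the sorted enumeration of its image, and two images of the same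
    size [k] coincide as soon as one contains the other. *)
Lemma increasing_codom_inj k n (I J : {ffun 'I_k -> 'I_n}) :
  increasing I -> increasing J -> {subset codom I <= codom J} -> I = J.
Proof.
move=> incI incJ subIJ.
have sorted_codom (K : {ffun 'I_k -> 'I_n}) :
    increasing K -> sorted ltn [seq val x | x <- codom K].
  move=> /forallP incK; rewrite /codom /image_mem -map_comp sorted_map.
  have: sorted (relpre val ltn) (enum 'I_k).
    by rewrite -sorted_map val_enum_ord iota_ltn_sorted.
  by apply: sub_sorted => i j /= ij; exact: (implyP (forallP (incK i) j)).
have eqIJ : codom I =i codom J.
  apply/subset_cardP; last by apply/fintype.subsetP.
  by rewrite !card_codom //; exact: increasing_inj.
have eq_graph : fgraph I = fgraph J.
  apply/val_inj; rewrite !fgraph_codom /=.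
  apply/(inj_map val_inj)/(irr_sorted_eq ltn_trans ltnn);
    rewrite ?sorted_codom //.
  exact: eq_mem_map.
exact: can_inj fgraphK _ _ eq_graph.
Qed.

Lemma form_normE (R : realType) k n (w : 'M[R]_(k, n) -> R) :
  form_norm w ^+ 2 =
  \sum_(I : {ffun 'I_k -> 'I_n} | increasing I) w (std_frame R I) ^+ 2.
Proof. by rewrite sqr_sqrtr // sumr_ge0 // => I _; rewrite sqr_ge0. Qed.

(** Permuting the entries of each increasing multi-index gives [k!] injective ones with the same
    squared value; by [h_inj] none of them is counted twice. *)
Lemma factorial_form_norm_le (R : realType) k n (w : 'M[R]_(k, n) -> R) :
  alternating_form w ->
  k`!%:R * form_norm w ^+ 2 <=
  \sum_(I : {ffun 'I_k -> 'I_n} | injectiveb I) w (std_frame R I) ^+ 2.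
Proof.
move=> w_alt.
pose h (p : 'S_k * {ffun 'I_k -> 'I_n}) := [ffun i => p.2 (p.1 i)].
pose P := [set p : 'S_k * {ffun 'I_k -> 'I_n} | increasing p.2]%SET.
have h_inj : {in P &, injective h}.
  move=> [s I] [t J]; rewrite !inE /= => incI incJ /ffunP hE.
  have IJ : I = J.
    apply: increasing_codom_inj incI incJ _ => _ /codomP[i ->].
    by have := hE (s^-1 i)%g; rewrite !ffunE /= permKV => ->; apply: codom_f.
  rewrite -IJ in hE *; congr (_, _); apply/permP => i.
  by have := hE i; rewrite !ffunE /= => /(increasing_inj incI).
have -> : k`!%:R * form_norm w ^+ 2 = \sum_(p in P) w (std_frame R (h p)) ^+ 2.
  rewrite form_normE -card_Sn mulr_natl -sumr_const pair_big_dep /=.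
  apply: eq_big => [[s I]|[s I] _]; first by rewrite !inE.
  rewrite -(alternating_row_perm_sqr w_alt _ s); congr (w _ ^+ 2).
  by apply/matrixP => i j; rewrite !mxE ffunE.
rewrite -(big_imset (fun I => w (std_frame R I) ^+ 2) h_inj) /=.
rewrite big_mkcond [leRHS]big_mkcond ler_sum // => I _.
case: imsetP => [[[s J]]|_]; last by case: ifP; rewrite ?sqr_ge0.
rewrite inE /= => incJ ->; case: injectiveP => // -[].
by move=> i j; rewrite !ffunE /= => /(increasing_inj incJ)/perm_inj.
Qed.

Definition ffun_cons k n (p : 'I_n * {ffun 'I_k -> 'I_n}) :
    {ffun 'I_k.+1 -> 'I_n} :=
  [ffun i => if unlift ord0 i is Some j then p.2 j else p.1].

Lemma ffun_cons_bij k n : bijective (@ffun_cons k n).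
Proof.
exists (fun I : {ffun 'I_k.+1 -> 'I_n} => (I ord0, [ffun j => I (lift ord0 j)]))
  => [[d f]|I].
  rewrite !ffunE unlift_none; congr (_, _); apply/ffunP => j.
  by rewrite !ffunE liftK.
by apply/ffunP => i; rewrite !ffunE; case: unliftP => [j|] ->; rewrite ?ffunE.
Qed.

Lemma set_row_std_frame (R : realType) k n d e (f : {ffun 'I_k -> 'I_n}) :
  set_row (std_frame R (ffun_cons (d, f))) ord0 (delta_mx 0 e) =
  std_frame R (ffun_cons (e, f)).
Proof.
apply/matrixP => i j; rewrite !mxE !ffunE eqxx /=.
case: unliftP => [l|] ->; last by rewrite eqxx eq_sym.
by rewrite [lift _ _ == _]eq_sym (negPf (neq_lift _ _)).
Qed.

(* The witness is the frame completing the basis vectors of index [f] by the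
   unit vector proportional to the contraction of [w] with them. *)
Lemma sum_sqr_le_comass (R : realType) k n (w : 'M[R]_(k.+1, n) -> R)
    (f : {ffun 'I_k -> 'I_n}) : alternating_form w ->
  \sum_d w (std_frame R (ffun_cons (d, f))) ^+ 2 <= comass w ^+ 2.
Proof.
move=> w_alt; pose c : 'rV[R]_n := \row_d w (std_frame R (ffun_cons (d, f))).
have -> : \sum_d w (std_frame R (ffun_cons (d, f))) ^+ 2 = vec_norm c ^+ 2.
  by rewrite vec_normE; apply: eq_bigr => d _; rewrite mxE.
have [->|c0] := eqVneq (vec_norm c) 0; first by rewrite expr0n sqr_ge0.
(* [d0] merely fills the row that [V] overwrites; for [n = 0] there is no such index, but then [c]
   has norm 0. *)
have [d0 _|n0] := pickP 'I_n; last first.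
  by case/eqP: c0; rewrite /vec_norm big1 ?sqrtr0 // => d; have := n0 d.
pose V := set_row (std_frame R (ffun_cons (d0, f))) ord0 ((vec_norm c)^-1 *: c).
have VE : w V = vec_norm c.
  rewrite (alternating_row_expand w_alt V ord0) /V.
  transitivity (\sum_d (vec_norm c)^-1 * c 0 d ^+ 2).
    apply: eq_bigr => d _.
    by rewrite set_row_set_row set_row_std_frame !mxE eqxx -mulrA.
  by rewrite -mulr_sumr -vec_normE expr2 mulKf.
have c_ge0 : 0 <= vec_norm c by rewrite sqrtr_ge0.
suff: vec_norm c <= comass w.
  by move=> le_c; rewrite lerXn2r ?nnegrE // (le_trans c_ge0).
rewrite -VE le_comass // => i.
have [->|i0] := eqVneq i ord0; last first.
  by rewrite row_set_row_neq // row_std_frame vec_norm_delta.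
rewrite row_set_row; apply/vec_norm1; under eq_bigr do rewrite mxE exprMn.
by rewrite -mulr_sumr -vec_normE -exprMn mulVf // expr1n.
Qed.

(** Removing the first entry of an injective multi-index leaves an injective [f], for which there
    are [n ^_ k] choices; [sum_sqr_le_comass] bounds the sum over the first entry for each [f]. *)
Lemma form_norm_le_comass (R : realType) k n (w : 'M[R]_(k.+1, n) -> R) :
  alternating_form w ->
  k.+1`!%:R * form_norm w ^+ 2 <= (n ^_ k)%:R * comass w ^+ 2.
Proof.
move=> w_alt; apply: le_trans (factorial_form_norm_le w_alt) _.
rewrite (reindex _ (onW_bij _ (ffun_cons_bij k n))) /=.
have -> : (n ^_ k)%:R * comass w ^+ 2 =
    \sum_(f : {ffun 'I_k -> 'I_n} | injectiveb f) comass w ^+ 2.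
  have := card_inj_ffuns 'I_k 'I_n; rewrite cardsE !card_ord => <-.
  by rewrite sumr_const mulr_natl.
apply: (@le_trans _ _ (\sum_(f : {ffun 'I_k -> 'I_n} | injectiveb f)
    \sum_d w (std_frame R (ffun_cons (d, f))) ^+ 2)); last first.
  by apply: ler_sum => f _; exact: sum_sqr_le_comass.
(* Letting [d] also range over the image of [f] only adds squares. *)
rewrite exchange_big pair_big_dep big_mkcond [leRHS]big_mkcond /=.
apply: ler_sum => -[d f] _.
case: injectiveP => [inj_df|_]; last by case: ifP; rewrite ?sqr_ge0.
rewrite ifT //; apply/injectiveP => i j fij.
by apply: (@lift_inj _ ord0); apply: inj_df; rewrite !ffunE !liftK.
Qed.

(** * Basis forms as minors, and their Hodge duals *)

Definition minor (R : realType) k n (c : {ffun 'I_k -> 'I_n})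
    (V : 'M[R]_(k, n)) : R :=
  \det (colsub c V).

Lemma alternating_minor (R : realType) k n (c : {ffun 'I_k -> 'I_n}) :
  alternating_form (@minor R k n c).
Proof.
split=> [A B C i b d|A i j ij] rows; last first.
  apply: determinant_alternate ij _ => q.
  by have /rowP/(_ (c q)) := rows; rewrite !mxE.
move=> rowB rowC; apply: (@determinant_multilinear _ _ _ _ _ i).
- by apply/rowP => q; have /rowP/(_ (c q)) := rows; rewrite !mxE.
- by apply/matrixP => p q; have /matrixP/(_ p (c q)) := rowB; rewrite !mxE.
- by apply/matrixP => p q; have /matrixP/(_ p (c q)) := rowC; rewrite !mxE.
Qed.

Lemma alternating_sum (R : realType) k n (T : Type) (s : seq T) (a : T -> R)
    (w : T -> 'M[R]_(k, n) -> R) :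
  (forall t, alternating_form (w t)) ->
  alternating_form (fun V => \sum_(t <- s) a t * w t V).
Proof.
move=> w_alt; split=> [A B C i b d rowA rowB rowC|A i j ij rowij].
  rewrite !mulr_sumr -big_split /=; apply: eq_bigr => t _.
  by rewrite ((w_alt t).1 _ _ _ _ _ _ rowA rowB rowC); ring.
by apply: big1 => t _; rewrite ((w_alt t).2 _ _ _ ij rowij) mulr0.
Qed.

(** If [I] differs from [c], some [I i] lies outside the image of [c], and row [i] of the selected
    submatrix vanishes. *)
Lemma minor_std_frame (R : realType) k n (I c : {ffun 'I_k -> 'I_n}) :
  increasing I -> increasing c -> minor c (std_frame R I) = (I == c)%:R.
Proof.
move=> incI incc; case: eqP => [->|Ic].
  rewrite /minor; suff -> : colsub c (std_frame R c) = 1%:M by rewrite det1.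
  by apply/matrixP => i j; rewrite !mxE (inj_eq (increasing_inj incc)).
have [i Ii] : exists i, I i \notin codom c.
  apply/existsP; apply: contra_notT Ic => /existsPn codIc.
  apply: increasing_codom_inj incI incc _ => _ /codomP[i ->].
  by have := codIc i; rewrite negbK.
rewrite /minor (expand_det_row _ i) big1 // => j _; rewrite !mxE.
case: eqP => [Iij|]; last by rewrite mul0r.
by move: Ii; rewrite Iij codom_f.
Qed.

Lemma hodge_minor (R : realType) k m (c : {ffun 'I_k -> 'I_(k + m)}) V :
  increasing c ->
  hodge (@minor R k (k + m) c) V = \det (col_mx (std_frame R c) V).
Proof.
move=> incc; rewrite /hodge (bigD1 c) //= minor_std_frame // eqxx mul1r.
rewrite big1 ?addr0 // => I /andP[incI /negPf Ic].
by rewrite minor_std_frame // Ic mul0r.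
Qed.

(** Lists carry the indices 1 to 8 of the statement, ordinals start at 0, hence the predecessor. *)
Definition indices (s : seq nat) : {ffun 'I_4 -> 'I_8} :=
  [ffun i : 'I_4 => inord (nth 0%N s i).-1].

Lemma wedge_dual_basis (R : realType) j k l m :
  wedge [tuple dual_basis R j; dual_basis R k; dual_basis R l; dual_basis R m]
  = minor (indices [:: j; k; l; m]).
Proof.
apply/funext => V; rewrite /wedge /minor -det_tr; congr (\det _).
apply/matrixP => p q; rewrite !mxE !ffunE (tnth_nth (dual_basis R 0)) /=.
by case: q => -[|[|[|[|//]]]] ? /=; rewrite /dual_basis mxE.
Qed.

Definition multi_index (s : seq nat) : bool :=
  [&& size s == 4, sorted ltn s & all (fun j => 0 < j <= 8)%N s].

Lemma val_indices s i : multi_index s -> (val (indices s i)).+1 = nth 0%N s i.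
Proof.
case/and3P=> /eqP size_s _ /(all_nthP 0%N)/(_ i); rewrite size_s ltn_ord.
by move=> /(_ isT)/andP[s_gt0 s_le]; rewrite ffunE /= inordK prednK.
Qed.

Lemma increasing_indices s : multi_index s -> increasing (indices s).
Proof.
move=> s_idx; apply/forallP => i; apply/forallP => j; apply/implyP => ij.
rewrite -ltnS !val_indices //; case/and3P: s_idx => /eqP size_s s_sorted _.
by apply: (sorted_ltn_nth ltn_trans) => //; rewrite inE size_s.
Qed.

Lemma indices_inj s t :
  multi_index s -> multi_index t -> indices s = indices t -> s = t.
Proof.
move=> s_idx t_idx st.
have /eqP size_s : size s == 4 by case/and3P: s_idx.
have /eqP size_t : size t == 4 by case/and3P: t_idx.
apply: (@eq_from_nth _ 0%N) => [|i]; first by rewrite size_s size_t.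
rewrite size_s => i4.
by rewrite -(val_indices (Ordinal i4) s_idx) st val_indices.
Qed.

(* Determinants of functions of natural indices: the columns of an iterated minor
   are then plain compositions of [bump], which compute. *)
Definition ndet (R : realType) n (a : nat -> nat -> R) : R :=
  \det (\matrix_(i < n, j < n) a i j).

Lemma ndetS (R : realType) n (a : nat -> nat -> R) :
  ndet n.+1 a = \sum_(j < n.+1)
    a 0%N j * ((-1) ^+ j * ndet n (fun p q => a p.+1 (bump j q))).
Proof.
rewrite /ndet (expand_det_row _ ord0); apply: eq_bigr => j _.
rewrite mxE /cofactor; congr (_ * (_ * \det _)).
by apply/matrixP => p q; rewrite !mxE.
Qed.

Lemma ndet_delta_row (R : realType) n (a : nat -> nat -> R) j :
  (j <= n)%N -> (forall q, a 0%N q = (q == j)%:R) ->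
  ndet n.+1 a = (-1) ^+ j * ndet n (fun p q => a p.+1 (bump j q)).
Proof.
rewrite -ltnS => jn a0; rewrite ndetS (bigD1 (Ordinal jn)) //= a0 eqxx mul1r.
rewrite big1 ?addr0 // => i /negPf ij.
rewrite a0 -[X in X == j]/(val i) -[j in _ == j]/(val (Ordinal jn)).
by rewrite val_eqE ij mul0r.
Qed.

(* Four successive Laplace expansions delete the columns j, k, l, m; each index is
   shifted down by the number of columns deleted before. *)
Definition complement_indices (j k l m : nat) : seq nat :=
  [seq (bump j.-1 (bump k.-2 (bump l.-2.-1 (bump m.-2.-2 q)))).+1
  | q <- iota 0 4].

(** The Hodge dual of a basis form is the determinant whose top four rows are basis vectors;
    expanding along these rows leaves the complementary minor up to sign. *)
Lemma sd_formE (R : realType) j k l m :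
  multi_index [:: j; k; l; m] ->
  sd_form R j k l m = minor (indices [:: j; k; l; m]) +
    (fun V => (-1) ^+ odd (j + k + l + m) *
       minor (indices (complement_indices j k l m)) V).
Proof.
move=> jklm; rewrite /sd_form wedge_dual_basis; congr (_ + _).
apply/funext => V; rewrite hodge_minor; last exact: increasing_indices.
pose a (p q : nat) : R :=
  if (p < 4)%N then (q == (nth 0%N [:: j; k; l; m] p).-1)%:R
  else V (inord (p - 4)) (inord q).
have -> : \det (col_mx (std_frame R (indices [:: j; k; l; m])) V) = ndet 8 a.
  congr (\det _); apply/matrixP => p q; rewrite !mxE /a.
  case: splitP => p' -> /=.
    rewrite ltn_ord !mxE -(val_indices p' jklm) /= eq_sym.
    by rewrite -val_eqE.
  by rewrite addKn !inord_val.
move: jklm; rewrite /multi_index /= !andbT.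
move=> /andP[/and3P[jk kl lm] /and4P[jb kb lb mb]].
have bumpE i q r : (i < r)%N -> (bump i q == r) = (q == r.-1).
  by rewrite /bump; lia.
rewrite (@ndet_delta_row _ _ _ j.-1) //; last by lia.
rewrite (@ndet_delta_row _ _ _ k.-2); [|lia|]; last first.
  by move=> q; rewrite /a /= bumpE //; lia.
rewrite (@ndet_delta_row _ _ _ l.-2.-1); [|lia|]; last first.
  by move=> q; rewrite /a /= !bumpE //; lia.
rewrite (@ndet_delta_row _ _ _ m.-2.-2); [|lia|]; last first.
  by move=> q; rewrite /a /= !bumpE //; lia.
rewrite !mulrA -!exprD; congr (_ * _).
  (* The four exponents add up to [j + k + l + m - 10], and 10 is even. *)
  by rewrite -signr_odd; congr (_ ^+ nat_of_bool _); lia.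
rewrite /ndet /minor; congr (\det _); apply/matrixP => p q.
rewrite !mxE /a /=
   !subSS subn0 ffunE inord_val; congr (V _ (inord _)).
by rewrite /complement_indices (nth_map 0%N) ?size_iota // nth_iota.
Qed.

(** * The fourteen terms of the Cayley form and its Euclidean norm *)

(** The boolean [true] marks a minus sign. Each multi-index is followed by its complement, with the
    same sign because all seven sums [j + k + l + m] are even. *)
Definition cayley_terms : seq (bool * seq nat) :=
  [:: (false, [:: 1; 2; 3; 4]); (false, [:: 5; 6; 7; 8]);
      (false, [:: 1; 2; 5; 6]); (false, [:: 3; 4; 7; 8]);
      (false, [:: 1; 2; 7; 8]); (false, [:: 3; 4; 5; 6]);
      (false, [:: 1; 3; 5; 7]); (false, [:: 2; 4; 6; 8]);
      (true, [:: 1; 3; 6; 8]); (true, [:: 2; 4; 5; 7]);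
      (true, [:: 1; 4; 5; 8]); (true, [:: 2; 3; 6; 7]);
      (true, [:: 1; 4; 6; 7]); (true, [:: 2; 3; 5; 8])]%N.

Lemma cayley_formE (R : realType) :
  cayley_form R = (fun V => \sum_(t <- cayley_terms)
                     (-1) ^+ t.1 * minor (indices t.2) V).
Proof.
apply/funext => V; rewrite /cayley_form !sd_formE // !big_cons big_nil /=.
by rewrite !fctE !expr0 expr1; ring.
Qed.

Lemma cayley_terms_multi_index t : t \in cayley_terms -> multi_index t.2.
Proof. by move: t; apply/allP. Qed.

Lemma cayley_form_std_frame (R : realType) t :
  t \in cayley_terms -> cayley_form R (std_frame R (indices t.2)) = (-1) ^+ t.1.
Proof.
move=> tT; have incT t' : t' \in cayley_terms -> increasing (indices t'.2).
  by move=> /cayley_terms_multi_index/increasing_indices.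
rewrite cayley_formE (bigD1_seq t) //= minor_std_frame ?incT // eqxx mulr1.
rewrite big_seq_cond big1 ?addr0 // => t' /andP[t'T t't].
rewrite minor_std_frame ?incT //; case: eqP => [tt'|]; last by rewrite mulr0.
have t2 : t.2 = t'.2.
  by apply: indices_inj tt'; exact: cayley_terms_multi_index.
(* The fourteen multi-indices are pairwise distinct, by computation. *)
have inj2 : all (fun x => all (fun y => (x.2 == y.2) ==> (x == y)) cayley_terms)
  cayley_terms by [].
have := implyP (allP (allP inj2 _ t'T) _ tT); rewrite t2 eqxx => /(_ isT) tt.
by rewrite tt in t't.
Qed.

(** Expanding only one factor of each squared coefficient and exchanging the sums, every term
    contributes its sign times the coefficient at its own multi-index, that is 1. *)
Lemma cayley_form_norm (R : realType) : form_norm (cayley_form R) ^+ 2 = 14%:R.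
Proof.
have incT t : t \in cayley_terms -> increasing (indices t.2).
  by move=> /cayley_terms_multi_index/increasing_indices.
rewrite form_normE.
transitivity (\sum_(I | increasing I)
    \sum_(t <- cayley_terms | t \in cayley_terms)
    (-1) ^+ t.1 * (I == indices t.2)%:R * cayley_form R (std_frame R I)).
  apply: eq_bigr => I incI; rewrite expr2 {1}cayley_formE mulr_suml big_seq.
  by apply: eq_bigr => t tT; rewrite minor_std_frame ?incT.
rewrite exchange_big /=.
transitivity (\sum_(t <- cayley_terms | t \in cayley_terms) (1 : R)).
  apply: eq_bigr => t tT; rewrite (bigD1 (indices t.2)) ?incT //= eqxx mulr1.
  rewrite cayley_form_std_frame // -signr_addb addbb big1 ?addr0 //.
  by move=> I /andP[_ /negPf->]; rewrite mulr0 mul0r.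
by rewrite -big_seq big_const_seq count_predT iter_addr_0.
Qed.

(** * The triple cross product and the comass of the Cayley form *)

(** Vectors become functions of natural indices, so that minors expand to explicit polynomials on
    which [ring] can work. *)
Definition quad (R : realType) (u v w x : nat -> R) (s : seq nat) : R :=
  ndet 4 (fun i j => nth (fun=> 0) [:: u; v; w; x] i (nth 0%N s j).-1).

Definition cayley (R : realType) (u v w x : nat -> R) : R :=
  \sum_(t <- cayley_terms) (-1) ^+ t.1 * quad u v w x t.2.

Definition dot (R : realType) (u v : nat -> R) : R := \sum_(i < 8) u i * v i.

(* [X u v w] of the header: its [i]-th coordinate is the value of the Cayley form
   on [u, v, w, e_i]. *)
Definition cross (R : realType) (u v w : nat -> R) (i : nat) : R :=
  cayley u v w (fun j => (i == j)%:R).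

Lemma quadE (R : realType) (u v w x : nat -> R) a b c d :
  quad u v w x [:: a; b; c; d] =
  let m2 p q := w p * x q - w q * x p in
  let m3 p q r := v p * m2 q r - v q * m2 p r + v r * m2 p q in
  u a.-1 * m3 b.-1 c.-1 d.-1 - u b.-1 * m3 a.-1 c.-1 d.-1
  + u c.-1 * m3 a.-1 b.-1 d.-1 - u d.-1 * m3 a.-1 b.-1 c.-1.
Proof.
rewrite /quad !(ndetS, big_ord_recl, big_ord0) /ndet !det_mx00 /bump /=.
ring.
Qed.

Lemma dot_cross (R : realType) (u v w x : nat -> R) :
  dot (cross u v w) x = cayley u v w x.
Proof.
rewrite /dot !big_ord_recl big_ord0 /bump /= /cross /cayley.
rewrite !big_cons !big_nil /=.
rewrite !quadE /=; ring.
Qed.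

(** A polynomial identity in 24 coordinates. It says that the squared norm of the cross product is
    the Gram determinant of [u], [v], [w]; the defect [p] vanishes on orthogonal triples. *)
Lemma dot_cross_cross (R : realType) (u v w : nat -> R) :
  let p i := dot u v * w i - dot u w * v i + dot v w * u i in
  dot (cross u v w) (cross u v w) + dot p p = dot u u * dot v v * dot w w.
Proof.
rewrite /dot !big_ord_recl !big_ord0 /bump /= /cross /cayley.
rewrite !big_cons !big_nil /=.
rewrite !quadE /=. ring.
Qed.

Lemma cayley_le1 (R : realType) (u v w x : nat -> R) :
  dot u u = 1 -> dot v v = 1 -> dot w w = 1 -> dot x x = 1 ->
  cayley u v w x <= 1.
Proof.
move=> u1 v1 w1 x1.
have dot_ge0 (y : nat -> R) : 0 <= dot y y.
  by apply: sumr_ge0 => i _; rewrite -expr2 sqr_ge0.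
have := dot_cross_cross u v w; rewrite u1 v1 w1 !mul1r /=.
move: (fun i => _ + _) => p norm_cross.
(* In place of Cauchy-Schwarz: the squared distance from the cross product to [x] is nonnegative, so
   twice their inner product is at most 1 + 1. *)
have := dot_ge0 p; have := dot_ge0 (fun i => cross u v w i - x i).
have -> : dot (fun i => cross u v w i - x i) (fun i => cross u v w i - x i) =
    dot (cross u v w) (cross u v w) - 2 * dot (cross u v w) x + dot x x.
  rewrite /dot mulr_sumr -sumrB -big_split /=; apply: eq_bigr => i _; ring.
rewrite (dot_cross _ _ _ x) x1; lra.
Qed.

Lemma cayley_form_le1 (R : realType) (V : 'M[R]_(4, 8)) :
  (forall i, vec_norm (row i V) = 1) -> cayley_form R V <= 1.
Proof.
move=> V1; pose r (i j : nat) := V (inord i) (inord j).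
have r1 i : dot (r i) (r i) = 1.
  have /vec_norm1 <- := V1 (inord i).
  by apply: eq_bigr => j _; rewrite mxE /r inord_val expr2.
suff -> : cayley_form R V = cayley (r 0%N) (r 1%N) (r 2) (r 3).
  exact: cayley_le1.
rewrite cayley_formE; apply: eq_bigr => t _; congr (_ * \det _).
apply/matrixP => i j; rewrite !mxE ffunE.
by case: i => -[|[|[|[|//]]]] ?; congr (V _ _); apply/val_inj;
   rewrite /= inordK.
Qed.

Lemma alternating_cayley_form (R : realType) : alternating_form (cayley_form R).
Proof.
by rewrite cayley_formE; apply: alternating_sum => t; exact: alternating_minor.
Qed.

(** The frame of indices 1, 2, 3, 4 attains the bound of [cayley_form_le1]; it also shows that the
    set of values is nonempty, as [ge_sup] requires. *)
Lemma comass_cayley_form (R : realType) : comass (cayley_form R) = 1.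
Proof.
have V1 i : vec_norm (row i (std_frame R (indices [:: 1; 2; 3; 4]%N))) = 1.
  by rewrite row_std_frame vec_norm_delta.
have cV := @cayley_form_std_frame R (false, [:: 1; 2; 3; 4]%N) isT.
apply/eqP; rewrite eq_le; apply/andP; split; last first.
  by rewrite -[leLHS]cV; apply: le_comass V1; exact: alternating_cayley_form.
apply: ge_sup.
  by eexists; exists (std_frame R (indices [:: 1; 2; 3; 4]%N)).
by move=> _ [V VV1 <-]; exact: cayley_form_le1.
Qed.

Theorem theorem1p1 (R : realType) :
  [/\ alternating_form (cayley_form R) /\ cayley_form R <> 0,
      comass (cayley_form R) = 1,
      form_norm (cayley_form R) ^+ 2 / comass (cayley_form R) ^+ 2 = 14%:R
    & forall w : 'M[R]_(4, 8) -> R, alternating_form w -> w <> 0 ->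
        form_norm w ^+ 2 / comass w ^+ 2 <= 14%:R].
Proof.
split.
- split; first exact: alternating_cayley_form.
  move=> cayley0; have := cayley_form_norm R; rewrite form_normE cayley0 big1.
    by move=> /eqP; rewrite eq_sym pnatr_eq0.
  by move=> I _; rewrite expr0n.
- exact: comass_cayley_form.
- by rewrite comass_cayley_form cayley_form_norm expr1n divr1.
move=> w w_alt _; have := form_norm_le_comass w_alt.
(* The inverse of 0 is 0, so a zero comass would make the ratio 0. *)
have [->|c0] := eqVneq (comass w) 0; first by rewrite expr0n invr0 !mulr0 ler0n.
rewrite ler_pdivrMr ?exprn_even_gt0 //.
(* The count 336 of ordered triples is 14 times 24, and 24 cancels. *)
have -> : (8 ^_ 3 = 14 * 4`!)%N by [].
by rewrite natrM mulrAC [leRHS]mulrC ler_pM2l ?ltr0n ?fact_gt0.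
Qed.
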